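(* Consider the pure birth random tree process with parameter $\lambda>0$ (that is, $\mu=0$), and let $N(t)$ be the volume of the tree at time $t$. Then \[ \mathsf{E}\,N(t)=e^{\lambda t}, \] and \[ \lim_{t\to\infty}\frac{N(t)}{\mathsf{E}\,N(t)}=\mathrm{Exp}(1), \] where the limit is taken in distribution and $\mathrm{Exp}(1)$ denotes an exponentially distributed random variable with parameter $1$.
   Context: The process $G=\{G(t),t\ge0\}$ is a continuous-time Markov chain on finite directed trees rooted at a fixed vertex $v_0$, with $G(0)$ consisting of the single vertex $v_0$. At each vertex $v$ of the current tree, independently, a new edge with origin $v$ and ending at a new leaf is appended at the epochs of a Poisson process of rate $\lambda>0$. In the pure birth case $\mu=0$ no vertex is ever deleted. $N(t)$ is the total number of vertices of $G(t)$ (root included). *)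

(* Defs.v *)
From HB Require Import structures.
From mathcomp Require Import all_boot all_order all_algebra finmap.
From mathcomp Require Import all_classical all_reals all_analysis.

Set Implicit Arguments.
Unset Strict Implicit.
Unset Printing Implicit Defensive.

Import Order.TTheory GRing.Theory Num.Theory.
Import numFieldNormedType.Exports.

Local Open Scope classical_set_scope.
Local Open Scope ring_scope.

(* A directed graph is a pair (vertices, edges); vertices are natural numbers *)
(* and an edge (u, v) has origin u and end v.                                 *)
Definition digraph : Type := ({fset nat} * {fset nat * nat})%type.

Definition vertices (g : digraph) : {fset nat} := g.1.
Definition edges (g : digraph) : {fset nat * nat} := g.2.
Definition edge (g : digraph) : rel nat := [rel u v | (u, v) \in edges g].

(* The fixed root v_0. *)
Definition root_vertex : nat := 0%N.

(* Directed tree rooted at v_0: every vertex is reached from v_0 by exactly   *)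
(* one directed walk.                                                         *)
Definition is_rooted_tree (g : digraph) : Prop :=
  [/\ root_vertex \in vertices g,
      (forall e, e \in edges g -> e.1 \in vertices g /\ e.2 \in vertices g) &
      forall v, v \in vertices g ->
        exists! p, path (edge g) root_vertex p /\ last root_vertex p = v].

Definition rtree : Type := {g : digraph | `[< is_rooted_tree g >]}.

Definition volume (g : rtree) : nat := #|` vertices (val g)|.

Definition single_vertex : digraph := ([fset root_vertex], fset0)%fset.

(* The label given to a new vertex is a function of the current graph; labels *)
(* carry no randomness. Started from a single vertex, a tree grown by attach  *)
(* has vertices 0, ..., n-1 numbered by order of appearance.                  *)
Definition fresh_vertex (g : digraph) : nat :=
  (\max_(v <- vertices g) v).+1.

(* Append an edge with origin v ending at a new leaf. *)
Definition attach (v : nat) (g : digraph) : digraph :=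
  (fresh_vertex g |` vertices g, (v, fresh_vertex g) |` edges g)%fset.

Lemma single_vertex_rooted_tree : is_rooted_tree single_vertex.
Proof.
split=> [|e|v]; rewrite /vertices /edges /= ?in_fset1 ?in_fset0 //.
by move=> /eqP ->; exists [::]; split=> [//|[//|x p] []].
Qed.

Lemma fresh_vertexP (g : digraph) : fresh_vertex g \notin vertices g.
Proof.
apply/negP => gV.
have := leq_bigmax_seq (P := xpredT) (F := id) (fresh_vertex g) gV isT.
by rewrite {1}/fresh_vertex ltnn.
Qed.

Lemma attach_rooted_tree (v : nat) (g : digraph) :
  v \in vertices g -> is_rooted_tree g -> is_rooted_tree (attach v g).
Proof.
set w := fresh_vertex g => vV [rV EV tV].
have wV : w \notin vertices g := fresh_vertexP g.
have aE x y : edge (attach v g) x y = ((x == v) && (y == w)) || edge g x y.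
  by rewrite /edge /edges /= in_fset1U xpair_eqE.
have aV x : (x \in vertices (attach v g)) = (x == w) || (x \in vertices g).
  by rewrite /vertices /= in_fset1U.
have sub : subrel (edge g) (edge (attach v g)).
  by move=> x y xy; rewrite aE xy orbT.
have stay x p : x \in vertices g -> path (edge (attach v g)) x p ->
    last x p \in vertices g -> path (edge g) x p.
  elim: p x => //= y p IH x xV /andP[]; rewrite aE => /orP[|xy pp lp].
    case/andP=> _ /eqP ->; case: p {IH} => /= [|z p]; first by rewrite (negPf wV).
    rewrite aE => /andP[/orP[/andP[/eqP wv]|wz] _].
      by rewrite wv vV in wV.
    by have [/= wV'] := EV _ wz; rewrite wV' in wV.
  by rewrite xy /=; apply: IH => //; have [] := EV _ xy.
split=> [|e|x].
- by rewrite aV rV orbT.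
- rewrite {1}/edges /= in_fset1U => /orP[/eqP ->|/EV[e1 e2]].
    by rewrite !aV /= vV eqxx orbT.
  by rewrite !aV e1 e2 !orbT.
rewrite aV => /orP[/eqP ->|xV].
  have [p [[pp lp] up]] := tV _ vV.
  exists (rcons p w); split; first split.
  - by rewrite rcons_path (sub_path sub pp) aE lp !eqxx.
  - by rewrite last_rcons.
  case/lastP=> [|q y] []; first by move=> _ /= wr; rewrite -wr rV in wV.
  rewrite rcons_path last_rcons => /andP[pq lq] yw.
  move: lq; rewrite {}yw aE => /orP[/andP[/eqP lq _]|/EV[_ /= wV']]; last first.
    by rewrite wV' in wV.
  by congr rcons; apply: up; split=> //; apply: stay => //; rewrite lq.
have [p [[pp lp] up]] := tV _ xV.
exists p; split; first by rewrite (sub_path sub pp).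
by move=> q [pq lq]; apply: up; split=> //; apply: stay; rewrite ?lq.
Qed.

Section Processes.
Context d (T : measurableType d) (R : realType) (P : probability T R).

Definition mutually_independent (I : choiceType) (F : I -> set (set T)) : Prop :=
  forall (J : {fset I}) (A : I -> set T), (forall i, i \in J -> F i (A i)) ->
    P (\bigcap_(i in [set` J]) A i) = (\prod_(i <- J) P (A i))%E.

(* Events determined by a nat-valued random variable. *)
Definition events_of (X : T -> nat) : set (set T) :=
  [set X @^-1` B | B in [set: set nat]].

(* Sigma-algebra generated by a nat-valued process (X t), t >= 0. *)
Definition process_algebra (X : R -> T -> nat) : set (set T) :=
  <<s [set A | exists (t : R) n, 0 <= t /\ A = X t @^-1` [set n]] >>.

Record poisson_process (lambda : R) (X : R -> T -> nat) : Prop := {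
  poisson_measurable : forall (t : R) n, 0 <= t -> measurable (X t @^-1` [set n]) ;
  poisson_start : {ae P, forall w, X 0 w = 0%N} ;
  poisson_path : {ae P, forall w,
    (forall s t : R, 0 <= s -> s <= t -> (X s w <= X t w)%N) /\
    (forall t : R, 0 <= t -> \forall s \near t^'+, X s w = X t w)} ;
  poisson_increment : forall (s t : R) n, 0 <= s -> s < t ->
    P [set w | (X t w - X s w)%N = n] = (poisson_pmf (lambda * (t - s)) n)%:E ;
  poisson_independent : forall u : nat -> R,
    0 <= u 0%N -> {homo u : i j / (i <= j)%N >-> i <= j} ->
    mutually_independent
      (fun i : nat => events_of (fun w => (X (u i.+1) w - X (u i) w)%N)) }.

(* t is an epoch of the counting path of X: X(t-) <> X(t). *)
Definition epoch (X : R -> T -> nat) (w : T) (t : R) : Prop :=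
  ~ \forall s \near t^'-, X s w = X t w.

(* Time-homogeneous continuous-time Markov chain on a countable state space;  *)
(* p r x y is the probability of going from x to y in time r.                 *)
Record markov_chain (S : countType) (X : R -> T -> S) : Prop := {
  markov_measurable : forall (t : R) x, 0 <= t -> measurable (X t @^-1` [set x]) ;
  markov_property : exists p : R -> S -> S -> R,
    forall (n : nat) (u : nat -> R) (x : nat -> S),
    0 <= u 0%N -> {homo u : i j / (i <= j)%N >-> i <= j} ->
    P [set w | forall i, (i <= n.+1)%N -> X (u i) w = x i] =
    (P [set w | forall i, (i <= n)%N -> X (u i) w = x i] *
     (p (u n.+1 - u n) (x n) (x n.+1))%:E)%E }.

(* The clock of vertex v is clock v. Clocks run in absolute time and those of *)
(* vertices which are not in the tree yet are ignored. Almost surely no two   *)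
(* clocks have a common epoch, so that at most one vertex rings at a time.    *)
Record driven_by_clocks (lambda : R) (clock : nat -> R -> T -> nat)
    (G : R -> T -> rtree) : Prop := {
  clock_poisson : forall v, poisson_process lambda (clock v) ;
  clock_independent :
    mutually_independent (fun v : nat => process_algebra (clock v)) ;
  tree_start : {ae P, forall w, val (G 0 w) = single_vertex} ;
  tree_right_continuous : {ae P, forall w, forall t : R, 0 <= t ->
    \forall s \near t^'+, G s w = G t w} ;
  (* g is the left limit G(t-) *)
  tree_jump : {ae P, forall w, forall t : R, 0 < t -> exists g : rtree,
    [/\ \forall s \near t^'-, G s w = g,
        (forall v, v \in vertices (val g) -> epoch (clock v) w t ->
           val (G t w) = attach v (val g)) &
        ((forall v, v \in vertices (val g) -> ~ epoch (clock v) w t) ->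
           G t w = g)]} }.

(* Pure birth (mu = 0) random tree process with parameter lambda. The Markov  *)
(* property also follows from the independence of the clocks.                 *)
Definition pure_birth_tree (lambda : R) (G : R -> T -> rtree) : Prop :=
  markov_chain G /\ exists clock, driven_by_clocks lambda clock G.

(* Convergence in distribution, as t -> +oo, of the random variables X t to   *)
(* the law mu: convergence of the distribution functions at every point where *)
(* the distribution function of mu is continuous.                             *)
Definition converges_in_distribution (X : R -> T -> R) (mu : set R -> \bar R)
    : Prop :=
  forall x : R, {for x, continuous (fun y : R => mu `]-oo, y]%classic)} ->
    P [set w | X t w <= x] @[t --> +oo] --> mu `]-oo, x]%classic.

End Processes.

(* Main.v *)
Require Import Defs.
From HB Require Import structures.
From mathcomp Require Import all_boot all_order all_algebra finmap.
From mathcomp Require Import all_classical all_reals all_analysis.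
From mathcomp Require Import measurable_realfun ring lra.
Import Order.TTheory GRing.Theory Num.Theory.
Import numFieldNormedType.Exports.
Local Open Scope classical_set_scope.
Local Open Scope ring_scope.

(* N is approximated by an Euler scheme on the grid of mesh t / (m + 1): the   *)
(* population n grows by one whenever one of the clocks 0, ..., n - 1 rings    *)
(* during a cell. Near each time the tree has at most one jump, so by          *)
(* compactness the scheme is almost surely exact at time t once m is large.    *)
(* Independence of the increments of the clocks gives the distribution         *)
(* function F of the scheme through                                            *)
(*   F (k + 1) n = q ^ n * F k n + (1 - q ^ n) * F k (n - 1),                  *)
(* q being the probability that a clock is silent during a cell. Comparing     *)
(* with the geometric distribution function and letting m tend to infinity,    *)
(*   P (N t <= n) = 1 - (1 - exp (- lambda t)) ^ n.                            *)
(* Summing the tails gives the mean, and (1 - p) ^ floor (x / p) tends to      *)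
(* exp (- x) as p tends to 0.                                                  *)

(** With n vertices the total birth rate is n times [lambda], so the volume is a Yule process, and
    N(t) is geometric with success probability p = exp(-lambda t): this is [prob_volume_le]. A
    geometric variable has mean 1/p, and p times it tends to Exp(1) as p tends to 0. The hypotheses
    speak of clocks and paths, not of transition rates, so the geometric law is reached by
    discretization. [euler_exact] identifies N(t) with the scheme path by path, and [prob_euler_le]
    computes the law of the scheme by independence. The geometric distribution function with
    parameter [q ^+ k] satisfies the same recursion up to an error of order (1 - q)^2 per step
    ([euler_cdf_truncation]); over t / h steps of mesh h the errors add up to O(h)
    ([cvg_euler_cdf]). [cvg_prob_ae] passes to the limit. *)

(* r v k says that clock v rings during the k-th cell of a grid; the Euler     *)
(* scheme counts at most one birth per cell.                                   *)
Fixpoint euler (r : nat -> nat -> bool) (k : nat) : nat :=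
  if k is j.+1 then
    (euler r j + has (r^~ j) (iota 0 (euler r j)))%N
  else 1%N.

(** * Pathwise exactness of the scheme on fine grids *)

Section Paths.
Context {R : realType}.

(** A Lebesgue number argument: by compactness of [0, t], a fine enough mesh puts each cell inside
    one of the neighbourhoods on which [Q] holds. *)
Lemma local_to_grid (Q : R -> R -> Prop) (t : R) : 0 <= t ->
  (forall s, 0 <= s -> s <= t -> exists2 e, 0 < e &
     forall a b, 0 <= a -> s - e < a -> a <= b -> b < s + e -> Q a b) ->
  \forall m \near \oo, forall k, (k <= m)%N ->
    Q (k%:R * (t / m.+1%:R)) (k.+1%:R * (t / m.+1%:R)).
Proof.
move=> t0 loc.
have h0 m : 0 <= t / m.+1%:R by rewrite divr_ge0.
have := @segment_compact R 0 t => /compact_near_coveringP/near_covering_withinP.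
move=> /(_ nat \oo (fun m a => Q a (a + t / m.+1%:R)) (@eventually_filter)) cov.
have : \forall m \near \oo, `[0, t] `<=` (fun a => Q a (a + t / m.+1%:R)).
  apply: cov => s /=; rewrite in_itv /= => /andP[s0 st].
  have [e e0 Qe] := loc s s0 st.
  (* Half of the radius is for the left endpoint, half for the mesh, so that both ends of the cell
     stay within e of s. *)
  have e20 : 0 < e / 2 by rewrite divr_gt0.
  near=> a m => /=; rewrite in_itv /= => /andP[a0 _].
  have sa : `|s - a| < e / 2 by near: a; exact: nbhsx_ballx.
  have hm : t / m.+1%:R < e / 2.
    rewrite ltr_pdivrMr// mulrC -ltr_pdivrMr//.
    apply: (@lt_trans _ _ m%:R); last by rewrite ltr_nat.
    by near: m; exact: nbhs_infty_gtr.
  have {sa} /andP[sa1 sa2] : (- (e / 2) < s - a < e / 2) by rewrite -ltr_norml.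
  by move: (h0 m) hm; set h := t / _ => ? ?; apply: Qe => //; lra.
move=> [M _ subM]; exists M => // m /subM sub k km.
have -> : k.+1%:R * (t / m.+1%:R) = k%:R * (t / m.+1%:R) + t / m.+1%:R.
  by rewrite -natr1 mulrDl mul1r.
apply: sub; rewrite /= in_itv /= mulr_ge0//=.
rewrite mulrCA ler_piMr// ler_pdivrMr// mul1r ler_nat.
exact: leqW.
Unshelve. all: by end_near. Qed.

(** On a fine grid of [a, b] consecutive values agree by [local_to_grid]; chaining them joins a to
    b. *)
Lemma locally_constant_itv (f : R -> nat) (a b : R) : a <= b ->
  (forall s, a <= s -> \forall u \near s^'+, f u = f s) ->
  (forall s, a < s -> s <= b -> \forall u \near s^'-, f u = f s) ->
  f a = f b.
Proof.
move=> ab fr fl.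
have ba : 0 <= b - a by rewrite subr_ge0.
have [s s0 sba|m _ /(_ _ (leqnn m)) Hm] :=
    local_to_grid (fun x y => f (a + x) = f (a + y)) (b - a) ba.
  have as_ : a <= a + s by rewrite lerDl.
  have /= [e1 /= e10 E1] := fr _ as_.
  have [e2 e20 E2] : exists2 e, 0 < e &
      forall u, 0 <= u -> s - e < u -> u < s -> f (a + u) = f (a + s).
    have := s0; rewrite le_eqVlt => /predU1P[<-|s1].
      by exists 1 => // u u0 _; rewrite ltNge u0.
    have /= [||e /= e0 E] := fl (a + s); [by rewrite ltrDl|by lra|].
    exists e => // u u0 su us; apply: E => /=; last by rewrite ltrD2l.
    by rewrite opprD addrACA subrr add0r ger0_norm ?subr_ge0 ?ltW//; lra.
  have E u : 0 <= u -> s - Num.min e1 e2 < u -> u < s + Num.min e1 e2 ->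
      f (a + u) = f (a + s).
    move=> u0 su us; have [us'|su'|->//] := ltgtP u s.
      apply: E2 => //; apply: le_lt_trans su.
      by rewrite lerB// ge_min lexx orbT.
    apply: E1 => /=; last by rewrite ltrD2l.
    rewrite opprD addrACA subrr add0r ltr0_norm ?subr_lt0//.
    have : Num.min e1 e2 <= e1 by rewrite ge_min lexx.
    lra.
  exists (Num.min e1 e2); first by rewrite lt_min e10.
  by move=> x y x0 sx xy ys; rewrite !E//; lra.
have {Hm} H k : (k <= m.+1)%N -> f a = f (a + k%:R * ((b - a) / m.+1%:R)).
  by elim: k => [|k IH] km; [rewrite mul0r addr0|rewrite (IH (ltnW km)); exact: Hm].
by rewrite (H m.+1)// mulrC divfK ?pnatr_eq0// addrC subrK.
Qed.

Section TreePath.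
Variables (g : R -> rtree) (x : nat -> R -> nat).
Hypothesis x_mono : forall v s t, 0 <= s -> s <= t -> (x v s <= x v t)%N.
Hypothesis x_right : forall v t, 0 <= t -> \forall s \near t^'+, x v s = x v t.
Hypothesis g_start : val (g 0) = single_vertex.
Hypothesis g_right : forall t, 0 <= t -> \forall s \near t^'+, g s = g t.
Hypothesis g_jump : forall t : R, 0 < t -> exists g' : rtree,
  [/\ \forall s \near t^'-, g s = g',
      (forall v, v \in vertices (val g') ->
         ~ (\forall s \near t^'-, x v s = x v t) ->
         val (g t) = attach v (val g')) &
      ((forall v, v \in vertices (val g') ->
         ~ ~ (\forall s \near t^'-, x v s = x v t)) -> g t = g')].

Definition rings_within (a b : R) (v : nat) : bool := (x v b - x v a)%N != 0%N.

(** This invariant lets the scheme consult the clocks below the volume instead of those of the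
    vertex set. *)
Definition initial_labels (G : rtree) : Prop :=
  forall v, (v \in vertices (val G)) = (v < volume G)%N.

Definition exact_step (a b : R) : Prop := initial_labels (g a) ->
  initial_labels (g b) /\
  volume (g b) = (volume (g a) + has (rings_within a b) (iota 0 (volume (g a))))%N.

Lemma attach_neq (v : nat) (G : digraph) : attach v G <> G.
Proof.
move=> vG; have := fresh_vertexP G.
by rewrite -{2}vG /vertices /attach /= in_fset1U eqxx.
Qed.

Lemma attach_initial_labels (v : nat) (G H : rtree) :
  val H = attach v (val G) -> initial_labels G ->
  initial_labels H /\ volume H = (volume G).+1.
Proof.
move=> HG lG.
have vH : volume H = (volume G).+1.
  by rewrite /volume HG /vertices /= cardfsU1 fresh_vertexP.
have fr : fresh_vertex (val G) = volume G.
  have [n nG] : exists n, volume G = n.+1.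
    have [r0 _ _] : is_rooted_tree (val G) by apply/asboolP; exact: (valP G).
    by exists (volume G).-1; rewrite prednK//; rewrite lG in r0.
  rewrite /fresh_vertex nG; congr S; apply/eqP; rewrite eqn_leq; apply/andP; split.
    by apply/bigmax_leqP_seq => i; rewrite lG nG ltnS.
  by apply: (leq_bigmax_seq (F := id)) => //; rewrite lG nG.
split=> // u; rewrite HG vH /vertices /= in_fset1U fr ltnS leq_eqVlt.
by congr orb; exact: lG.
Qed.

(** An epoch of the clock of a present vertex would attach a leaf and change the tree
    ([attach_neq]). Hence these clocks have no epoch in the cell, are constant on it, and the scheme
    counts no birth. *)
Lemma constant_tree_exact_step (a b : R) : 0 <= a -> a <= b ->
  (forall s, a <= s -> s <= b -> g s = g a) -> exact_step a b.
Proof.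
move=> a0 ab ga la; rewrite ga//; split=> //.
rewrite (_ : has _ _ = false) ?addn0//; apply/hasP => -[v].
rewrite mem_iota /= add0n -la => va; rewrite /rings_within -(@locally_constant_itv (x v) a b)// ?subnn//.
  by move=> s as_; apply: x_right; exact: le_trans as_.
move=> s as_ sb; have [g' [gl ga' _]] := g_jump s (le_lt_trans a0 as_).
have gg' : g' = g a.
  near (s^'-) => u.
  have <- : g u = g' by near: u.
  have us : u < s by near: u; exact: nbhs_left_lt.
  by apply: ga; [near: u; exact: nbhs_left_ge|lra].
apply: contrapT => /(ga' v); rewrite gg' => /(_ va).
by rewrite (ga s (ltW as_) sb) => /esym /attach_neq.
Unshelve. all: by end_near. Qed.

(** Near s the tree takes one value before s and one from s on. A cell that does not straddle s sees
    a constant tree; one that does sees either a single attachment at s or no change. *)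
Lemma local_exact_step (s : R) : 0 <= s -> exists2 e, 0 < e &
  forall a b, 0 <= a -> s - e < a -> a <= b -> b < s + e -> exact_step a b.
Proof.
move=> s0.
have /= [e1 /= e10 E1] := g_right s s0.
have {}E1 u : s <= u -> u < s + e1 -> g u = g s.
  rewrite le_eqVlt => /predU1P[->//|su use]; apply: E1 => //=.
  by rewrite ltr0_norm ?subr_lt0//; lra.
have := s0; rewrite le_eqVlt => /predU1P[s0'|s1].
  exists e1 => // a b a0 _ ab be; apply: constant_tree_exact_step => // u au ub.
  by rewrite !E1 -?s0'//; lra.
have [g' [[e2 /= e20 E2] gatt gst]] := g_jump s s1.
have {}E2 u : s - e2 < u -> u < s -> g u = g'.
  move=> su us; apply: E2 => //=; rewrite ger0_norm ?subr_ge0 ?ltW//; lra.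
have e1m : Num.min e1 e2 <= e1 by rewrite ge_min lexx.
have e2m : Num.min e1 e2 <= e2 by rewrite ge_min lexx orbT.
exists (Num.min e1 e2) => [|a b a0 sa ab bs]; first by rewrite lt_min e10.
have [as_|sa'] := ltP a s; last first.
  by apply: constant_tree_exact_step => // u au ub; rewrite !E1//; lra.
have [bs'|sb] := ltP b s.
  by apply: constant_tree_exact_step => // u au ub; rewrite !E2//; lra.
have ga : g a = g' by apply: E2; lra.
have gb : g b = g s by apply: E1; lra.
have [[v vg nv]|nv] := pselect (exists2 v, v \in vertices (val g') &
    ~ (\forall s0 \near s^'-, x v s0 = x v s)).
  move=> la; have [lb vb] := attach_initial_labels v (g a) (g b)
    (etrans (congr1 val gb) (etrans (gatt v vg nv) (congr1 (attach v \o val) (esym ga)))) la.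
  split=> //; rewrite vb (_ : has _ _ = true) ?addn1//.
  apply/hasP; exists v; first by rewrite mem_iota add0n -la ga.
  rewrite /rings_within -lt0n subn_gt0.
  (* Otherwise the clock would be constant just before s, contradicting the epoch. By monotonicity
     this u gives a strict increment over the cell. *)
  have [u [au us xu]] : exists u, [/\ a <= u, u < s & x v u != x v s].
    apply: contrapT => nu; apply: nv; near=> u; apply/eqP/negPn/negP => xu.
    by apply: nu; exists u; split=> //; near: u; exact: nbhs_left_ge.
  apply: leq_ltn_trans (x_mono v a u a0 au) _.
  have u0 : 0 <= u by exact: le_trans au.
  apply: leq_trans (x_mono v s b s0 sb).
  by rewrite ltn_neqAle xu x_mono// ltW.
have gs : g s = g' by apply: gst => v vg nv'; apply: nv; exists v.
apply: constant_tree_exact_step => // u au ub; rewrite ga.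
by have [us|su] := ltP u s; [apply: E2|rewrite E1//]; lra.
Unshelve. all: by end_near. Qed.

Lemma euler_exact (t : R) : 0 <= t -> \forall m \near \oo,
  euler (fun v k => rings_within (k%:R * (t / m.+1%:R)) (k.+1%:R * (t / m.+1%:R)) v) m.+1
  = volume (g t).
Proof.
move=> t0; have [M _ HM] := local_to_grid exact_step t t0 (fun s s0 _ => local_exact_step s s0).
exists M => // m /HM H; set r := (fun v k => _).
have /(_ m.+1 (leqnn _))[_ ek] : forall k, (k <= m.+1)%N ->
    initial_labels (g (k%:R * (t / m.+1%:R))) /\
    euler r k = volume (g (k%:R * (t / m.+1%:R))).
  elim=> [_|k IH km].
    rewrite mul0r.
    have v1 : volume (g 0) = 1%N.
      by rewrite /volume g_start /vertices /= cardfs1.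
    split=> // v; rewrite v1 g_start /vertices /= in_fset1.
    by case: v.
  have [lk ek] := IH (ltnW km).
  have [lk' ek'] := H k km lk.
  by split=> //; rewrite ek' -ek.
by rewrite (mulrC m.+1%:R) divfK ?pnatr_eq0// in ek.
Qed.

End TreePath.
End Paths.

(** * Exact law of the scheme *)

Fixpoint euler_cdf {R : realType} (q : R) (k n : nat) : R :=
  if k is j.+1 then q ^+ n * euler_cdf q j n + (1 - q ^+ n) * euler_cdf q j n.-1
  else (0 < n)%N%:R.

(** A step adds at most one, so silence matters only when the population is exactly n. The clocks to
    inspect are then 0, ..., n - 1, a fixed set rather than one depending on the random
    population. *)
Lemma euler_leS (r : nat -> nat -> bool) (k n : nat) :
  (euler r k.+1 <= n)%N = ((euler r k <= n.-1)%N && (0 < n)%N) ||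
    ((euler r k <= n)%N && all (fun v => ~~ r v k) (iota 0 n)).
Proof.
case: n => [|n] /=; first by case: (euler r k).
rewrite andbT; set e := euler r k.
have [en|ne] := leqP e n.
  by rewrite (leq_trans (leq_add en (leq_b1 _)))// addn1.
have [en1|ne1] := leqP e n.+1; last first.
  by apply/negbTE; rewrite -ltnNge (leq_trans ne1)// leq_addr.
have -> : e = n.+1 by apply/eqP; rewrite eqn_leq en1.
rewrite -[X in (_ <= X)%N]addn0 leq_add2l leqn0 eqb0 -all_predC.
by [].
Qed.

Lemma measurable_increment_eq0 {d} {U : measurableType d} (f g : U -> nat) :
  (forall n, measurable (f @^-1` [set n])) ->
  (forall n, measurable (g @^-1` [set n])) ->
  measurable [set w | (g w - f w)%N = 0%N].
Proof.
move=> mf mg; rewrite (_ : [set _ | _] =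
  \bigcup_n (f @^-1` [set n] `&` \bigcup_(k in [set k | (k <= n)%N]) g @^-1` [set k])).
  by apply: bigcupT_measurable => n; apply: measurableI => //; apply: bigcup_measurable.
apply/seteqP; split=> [w /eqP|w [n _ [/= fn [k /= kn gk]]]].
  by rewrite subn_eq0 => gf; exists (f w) => //; split=> //; exists (g w).
by apply/eqP; rewrite subn_eq0 fn gk.
Qed.

Section Scheme.
Context {d} {T : measurableType d} {R : realType} (P : probability T R).
Variables (lambda : R) (clock : nat -> R -> T -> nat).
Hypothesis lambda_gt0 : 0 < lambda.
Hypothesis poisson : forall v, poisson_process P lambda (clock v).
Hypothesis indep : mutually_independent P (fun v : nat => process_algebra (clock v)).
Variable h : R.
Hypothesis h_ge0 : 0 <= h.

Let q : R := expR (- (lambda * h)).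

Definition rings (w : T) (v k : nat) : bool :=
  rings_within (fun v s => clock v s w) (k%:R * h) (k.+1%:R * h) v.

Let quiet (v k : nat) : set T := [set w | ~~ rings w v k].

Let quietE v k : quiet v k =
  [set w | (clock v (k.+1%:R * h) w - clock v (k%:R * h) w)%N = 0%N].
Proof.
by rewrite /quiet /rings /rings_within; apply/seteqP; split => w /=; rewrite negbK => /eqP.
Qed.

Lemma measurable_quiet v k : measurable (quiet v k).
Proof.
rewrite quietE; apply: measurable_increment_eq0 => n;
by apply: (poisson_measurable (poisson v)); rewrite mulr_ge0.
Qed.

Let quiet_process_algebra v k : process_algebra (clock v) (quiet v k).
Proof.
rewrite quietE.
apply: (@measurable_increment_eq0 _ (g_sigma_algebraType
  [set A | exists (t : R) n, 0 <= t /\ A = clock v t @^-1` [set n]])) => n;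
by apply: sub_sigma_algebra; do 2 eexists; split; last reflexivity; rewrite mulr_ge0.
Qed.

Let prob_quiet v k : P (quiet v k) = q%:E.
Proof.
rewrite quietE; have hS : k.+1%:R * h = k%:R * h + h by rewrite -natr1 mulrDl mul1r.
have [h0|h0] := ltP 0 h.
  rewrite (poisson_increment (poisson v)) ?mulr_ge0//; last by rewrite hS ltrDl.
  by rewrite hS addrAC subrr add0r /poisson_pmf mulr_gt0// expr0 fact0 divr1 mul1r.
(* Mesh zero occurs for t = 0; the increment then vanishes and q = 1. *)
have h00 : h = 0 by apply/eqP; rewrite eq_le h0.
rewrite (_ : [set _ | _] = setT) ?probability_setT /q ?h00 ?mulr0 ?oppr0 ?expR0//.
by apply/seteqP; split=> // w _ /=; rewrite subnn.
Qed.

Definition all_quiet (S : nat -> nat -> bool) (V m : nat) : set T :=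
  [set w | forall v k, (v < V)%N -> (k < m)%N -> S v k -> ~~ rings w v k].

Lemma measurable_all_quiet S V m : measurable (all_quiet S V m).
Proof.
rewrite (_ : all_quiet _ _ _ = \bigcap_(v in [set v | (v < V)%N])
  \bigcap_(k in [set k | (k < m)%N && S v k]) quiet v k).
  apply: bigcap_measurableType => v _; apply: bigcap_measurableType => k _.
  exact: measurable_quiet.
apply/seteqP; split=> w /= H v.
  by move=> vV k /andP[km Svk]; exact: H.
by move=> k vV km Svk; apply: H => //=; rewrite km.
Qed.

Let bigcap_fset_iota (n : nat) (A : nat -> set T) :
  \bigcap_(i in [set` [fset x in iota 0 n]%fset]) A i =
  [set w | forall i, (i < n)%N -> A i w].
Proof.
apply/seteqP; split=> w /= H i /=.
  by move=> ni; apply: H => /=; rewrite in_fset /= mem_iota.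
by rewrite in_fset /= mem_iota; exact: H.
Qed.

Let prod_fset_iota (n : nat) (F : nat -> \bar R) :
  (\prod_(i <- [fset x in iota 0 n]%fset) F i = \prod_(i < n) F i)%E.
Proof.
rewrite (perm_big (iota 0 n)); last first.
  by apply: uniq_perm; rewrite ?fset_uniq ?iota_uniq// => i; rewrite in_fset.
by rewrite -[n in iota _ n]subn0 big_mkord.
Qed.

(** Independence is used twice: between clocks, then between the cells of one clock. Cells outside
    [S] contribute the sure event. *)
Lemma prob_all_quiet (S : nat -> nat -> bool) V m : P (all_quiet S V m) =
  (\prod_(v < V) \prod_(k < m) (if S v k then q else 1))%:E.
Proof.
pose A v := [set w | forall k, (k < m)%N -> S v k -> ~~ rings w v k].
rewrite (_ : all_quiet _ _ _ = [set w | forall v, (v < V)%N -> A v w]); last first.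
  by apply/seteqP; split=> w /= H v; [move=> vV k; exact: H|move=> k vV; exact: H].
rewrite -bigcap_fset_iota indep; last first.
  move=> v _; rewrite (_ : A v = \bigcap_(k in [set k | (k < m)%N && S v k]) quiet v k).
    apply: (@bigcap_measurableType _ (g_sigma_algebraType
      [set A | exists (t : R) n, 0 <= t /\ A = clock v t @^-1` [set n]])) => k _.
    exact: quiet_process_algebra.
  apply/seteqP; split=> w /= H k; first by move=> /andP[km Svk]; exact: H.
  by move=> km Svk; apply: H => /=; rewrite km.
rewrite prod_fset_iota -prodEFin; apply: eq_bigr => v _.
pose B k := if S v k then quiet v k else setT.
rewrite (_ : A v = [set w | forall k, (k < m)%N -> B k w]); last first.
  apply/seteqP; split=> w /= H k km; have := H k km; rewrite /B; case: ifP => //=.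
  by move=> Svk; apply.
rewrite -bigcap_fset_iota (poisson_independent (poisson v) (u := fun k => k%:R * h)).
- rewrite prod_fset_iota -prodEFin; apply: eq_bigr => k _.
  by rewrite /B; case: ifP; rewrite ?prob_quiet ?probability_setT.
- by rewrite mul0r.
- by move=> i j ij; rewrite ler_wpM2r// ler_nat.
move=> k _; rewrite /B; case: ifP => _; last by exists setT; rewrite ?preimage_setT.
by exists [set 0%N] => //; rewrite quietE.
Qed.

Lemma measurable_euler_le k n : measurable [set w | (euler (rings w) k <= n)%N].
Proof.
elim: k n => [|k IH] n.
  by rewrite /=; case: (1 <= n)%N; [rewrite (_ : [set _ | _] = setT)|
    rewrite (_ : [set _ | _] = set0)] => //; apply/seteqP; split.
rewrite (_ : [set _ | _] =
  ([set w | (euler (rings w) k <= n.-1)%N] `&` [set w | (0 < n)%N]) `|`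
  ([set w | (euler (rings w) k <= n)%N] `&`
    \bigcap_(v in [set v | (v < n)%N]) quiet v k)).
  apply: measurableU; apply: measurableI => //; last first.
    by apply: bigcap_measurableType => v _; exact: measurable_quiet.
  by case: (0 < n)%N; [rewrite (_ : [set _ | _] = setT)|
    rewrite (_ : [set _ | _] = set0)] => //; apply/seteqP; split.
apply/seteqP; split=> w; rewrite /setU /setI /bigcap /quiet /mkset euler_leS.
  move=> /orP[/andP[? ?]|/andP[? /allP H]]; [left|right]; split=> //.
  by move=> v vn; apply: H; rewrite mem_iota.
move=> [[-> ->]//|[-> H]].
by apply/orP; right; apply/allP => v; rewrite mem_iota; exact: H.
Qed.

(* Intersecting with silence after step k makes the induction on k go through: *)
(* silence of the clocks v < n during cell k merely enlarges S, and ringing is *)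
(* handled as the complement of silence.                                       *)
Lemma prob_euler_le_all_quiet V m k n (S : nat -> nat -> bool) : (k <= m)%N -> (n <= V)%N ->
  (forall v j, S v j -> (k <= j)%N) ->
  P ([set w | (euler (rings w) k <= n)%N] `&` all_quiet S V m) =
  (euler_cdf q k n * \prod_(v < V) \prod_(j < m) (if S v j then q else 1))%:E.
Proof.
elim: k n S => [|k IH] n S km nV Sk.
  rewrite /=; have [n0|n0] := ltnP 0 n.
    by rewrite mul1r -prob_all_quiet (_ : [set _ | _] = setT) ?setTI//; apply/seteqP; split.
  rewrite mul0r (_ : [set _ | _] = set0) ?set0I ?measure0//.
  by apply/seteqP; split=> // w /=; rewrite ltnNge n0.
(* [S] only concerns cells after k, so adding the n clocks in cell k multiplies the probability by
   exactly [q ^+ n]. *)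
pose S' v j := S v j || ((j == k) && (v < n)%N).
have S'k v j : S' v j -> (k <= j)%N.
  by case/orP => [/Sk/ltnW//|/andP[/eqP ->]].
have prodS' : \prod_(v < V) \prod_(j < m) (if S' v j then q else 1) =
    q ^+ n * \prod_(v < V) \prod_(j < m) (if S v j then q else 1).
  rewrite -[q ^+ n](_ : \prod_(v < V) (if (v < n)%N then q else 1) = _); last first.
    by rewrite -big_mkcond -(big_ord_widen _ (fun=> q) nV) prodr_const card_ord.
  rewrite -big_split /=; apply: eq_bigr => v _.
  rewrite (bigD1 (Ordinal km)) //= [in RHS](bigD1 (Ordinal km)) //= mulrA.
  rewrite /S' eqxx /=; have /negbTE -> : ~~ S v k.
    by apply/negP => /Sk; rewrite ltnn.
  rewrite mulr1; congr (_ * _); apply: eq_bigr => j /negbTE jk.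
  by rewrite -[_ == k]/(j == Ordinal km) jk orbF.
have mE := measurable_euler_le.
have mQ := measurable_all_quiet.
have euler_gt0 w j : (0 < euler (rings w) j)%N.
  by elim: j => //= j ?; rewrite addn_gt0; apply/orP; left.
rewrite (_ : _ `&` _ = ([set w | (euler (rings w) k <= n.-1)%N] `&` all_quiet S V m) `|`
   ([set w | (euler (rings w) k <= n)%N] `&` all_quiet S' V m)); last first.
  apply/seteqP; split=> w; rewrite /setU /setI /all_quiet /mkset euler_leS.
    move=> [/orP[/andP[en _]|/andP[en /allP all_n]] Sw]; [by left|right].
    split=> // v j vV jm /orP[Svj|/andP[/eqP -> vn]]; first exact: Sw.
    by apply: all_n; rewrite mem_iota.
  move=> [[en Sw]|[en Sw]]; split=> //.
  - rewrite en /=; apply/orP; left; case: n en {nV S' S'k prodS'} => //.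
    by move: (euler_gt0 w k); case: euler.
  - rewrite en; apply/orP; right; apply/allP => v; rewrite mem_iota /= => vn.
    by apply: Sw => //; [exact: leq_trans nV|rewrite /S' eqxx vn orbT].
  - by move=> v j vV jm Svj; apply: Sw => //; rewrite /S' Svj.
(* Inclusion-exclusion: the intersection carries the factor [q ^+ n] with n - 1, and subtracting it
   produces the weight 1 - q^n of the recursion. *)
have II : ([set w | (euler (rings w) k <= n.-1)%N] `&` all_quiet S V m) `&`
   ([set w | (euler (rings w) k <= n)%N] `&` all_quiet S' V m) =
   [set w | (euler (rings w) k <= n.-1)%N] `&` all_quiet S' V m.
  apply/seteqP; split=> w /= [en Sw]; first by case: en Sw => ? _ [].
  split; split=> //; last exact: leq_trans (leq_pred n).
  by move=> v j vV jm Svj; apply: Sw => //; rewrite /S' Svj.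
have PU A B : measurable A -> measurable B ->
    P (A `|` B) = (P A + P B - P (A `&` B))%E.
  by move=> mA mB; rewrite measureUfinl ?ltey_eq ?fin_num_measure.
rewrite PU; [|exact: measurableI|exact: measurableI].
have nV' : (n.-1 <= V)%N by exact: leq_trans (leq_pred _) nV.
rewrite II !IH ?(ltnW km)//; last by move=> v j /Sk /ltnW.
rewrite prodS' -!EFinD; congr EFin => /=; lra.
Qed.

Lemma prob_euler_le k n :
  P [set w | (euler (rings w) k <= n)%N] = (euler_cdf q k n)%:E.
Proof.
have := prob_euler_le_all_quiet n k k n (fun _ _ => false) (leqnn _) (leqnn _).
rewrite (_ : all_quiet _ _ _ = setT) ?setIT => [->//|].
  by rewrite big1 ?mulr1// => v _; rewrite big1.
by apply/seteqP; split=> // w _ v k0.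
Qed.

End Scheme.

(** * Comparison with the geometric law, and limits *)

Section EulerCdf.
Context {R : realType}.
Implicit Types a b p q : R.

(** First-order Taylor expansion. Each induction step multiplies the remainder by a + b and adds at
    most (n + 1) b^2, which the growth of the squared constant absorbs. *)
Lemma pow_linearization a b n : `|a| <= 1 -> `|a + b| <= 1 ->
  `|(a + b) ^+ n.+1 - a ^+ n.+1 - n.+1%:R * a ^+ n * b| <= n.+1%:R ^+ 2 * b ^+ 2.
Proof.
move=> a1 ab1; elim: n => [|n IH].
  by rewrite !expr1 expr0 !mul1r expr1n mul1r (_ : _ - _ = 0) ?normr0 ?sqr_ge0//; lra.
rewrite (_ : _ - _ = (a + b) * ((a + b) ^+ n.+1 - a ^+ n.+1 - n.+1%:R * a ^+ n * b)
   + n.+1%:R * a ^+ n * b ^+ 2); last first.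
  by rewrite (exprS (a + b) n.+1) (exprS a n.+1) -(natr1 n.+1) (exprS a n); ring.
rewrite (le_trans (ler_normD _ _))//.
have -> : n.+2%:R ^+ 2 * b ^+ 2 =
    n.+1%:R ^+ 2 * b ^+ 2 + (n.+1%:R + n.+2%:R) * b ^+ 2 :> R.
  by rewrite -(natr1 n.+1); ring.
apply: lerD.
  by rewrite normrM (le_trans (ler_pM _ _ ab1 IH))// mul1r.
rewrite normrM (ger0_norm (sqr_ge0 b)) ler_wpM2r ?sqr_ge0//.
rewrite normrM normr_nat normrX (@le_trans _ _ n.+1%:R) ?lerDl//.
by rewrite ler_piMr// exprn_ile1.
Qed.

(** The first-order terms in 1 - q cancel. What is left are the Taylor remainders of (1 - pq)^n,
    with 1 - pq = (1 - p) + p (1 - q), and of q^n; hence the factor 2. *)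
Lemma euler_cdf_truncation p q n : 0 <= p <= 1 -> 0 <= q <= 1 ->
  `|(1 - (1 - p * q) ^+ n) -
    (q ^+ n * (1 - (1 - p) ^+ n) + (1 - q ^+ n) * (1 - (1 - p) ^+ n.-1))|
  <= 2 * n%:R ^+ 2 * (1 - q) ^+ 2.
Proof.
move=> /andP[p0 p1] /andP[q0 q1]; case: n => [|n].
  by rewrite !expr0 !subrr !mul0r mulr0 addr0 subrr normr0 expr0n/= mulr0 mul0r.
have pq0 : 0 <= p * q by rewrite mulr_ge0.
have pq1 : p * q <= 1 by rewrite mulr_ile1.
set d1 := (1 - p + p * (1 - q)) ^+ n.+1 - (1 - p) ^+ n.+1
  - n.+1%:R * (1 - p) ^+ n * (p * (1 - q)).
have hd1 : `|d1| <= n.+1%:R ^+ 2 * (p * (1 - q)) ^+ 2.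
  by apply: pow_linearization; rewrite ger0_norm; lra.
set d2 := (1 + - (1 - q)) ^+ n.+1 - 1 ^+ n.+1 - n.+1%:R * 1 ^+ n * - (1 - q).
have hd2 : `|d2| <= n.+1%:R ^+ 2 * (- (1 - q)) ^+ 2.
  by apply: pow_linearization; rewrite ger0_norm; lra.
have e1 : (1 - p * q) ^+ n.+1 = d1 + (1 - p) ^+ n.+1
    + n.+1%:R * (1 - p) ^+ n * (p * (1 - q)).
  by rewrite /d1 (_ : 1 - p + _ = 1 - p * q); ring.
have e2 : q ^+ n.+1 = d2 + 1 - n.+1%:R * (1 - q).
  by rewrite /d2 (_ : 1 + _ = q) ?expr1n; ring.
rewrite (_ : _ - _ = - (d1 + (1 - p) ^+ n * p * d2)); last first.
  by rewrite e1 e2 [n.+1.-1]/= (exprS (1 - p) n); ring.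
rewrite normrN (le_trans (ler_normD _ _))//.
rewrite -[2 * _ * _]mulrA mulr2n [leRHS]mulrDl mul1r lerD//.
  apply: le_trans hd1 _; rewrite ler_wpM2l ?sqr_ge0// exprMn ler_piMl ?sqr_ge0//.
  by rewrite exprn_ile1.
rewrite sqrrN in hd2; apply: le_trans hd2.
have r01 : 0 <= (1 - p) ^+ n <= 1 by rewrite exprn_ge0 ?exprn_ile1//; lra.
move: r01 => /andP[r0 r1].
by rewrite normrM ler_piMl// ger0_norm ?mulr_ge0// mulr_ile1.
Qed.

(* The Euler recursion averages two values with weights q ^+ n and 1 - q ^+ n, *)
(* so the truncation errors of the successive steps simply add up.             *)
Lemma euler_cdf_error q k n V : 0 <= q <= 1 -> (n <= V)%N ->
  `|1 - (1 - q ^+ k) ^+ n - euler_cdf q k n| <= k%:R * (2 * V%:R ^+ 2 * (1 - q) ^+ 2).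
Proof.
move=> q01; have /andP[q0 q1] := q01.
elim: k n => [|k IH] n nV.
  by rewrite expr0 subrr mul0r /= expr0n lt0n; case: eqP; rewrite /= ?subrr ?subr0 ?subrr normr0.
have p01 : 0 <= q ^+ k <= 1 by rewrite exprn_ge0// exprn_ile1.
have tr := euler_cdf_truncation (q ^+ k) q n p01 q01.
have IHn := IH n nV.
have IHn1 := IH n.-1 (leq_trans (leq_pred _) nV).
have qn0 : 0 <= q ^+ n by rewrite exprn_ge0.
have qn1 : q ^+ n <= 1 by rewrite exprn_ile1.
rewrite exprSr /=.
set B := 2 * V%:R ^+ 2 * (1 - q) ^+ 2 in IHn IHn1 *.
have trB : 2 * n%:R ^+ 2 * (1 - q) ^+ 2 <= B.
  rewrite ler_wpM2r ?sqr_ge0// ler_wpM2l// lerXn2r ?nnegrE//.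
  by rewrite ler_nat.
move: IHn IHn1 tr.
set x := 1 - (1 - q ^+ k) ^+ n; set y := 1 - (1 - q ^+ k) ^+ n.-1.
set z := 1 - _ ^+ n; set s := q ^+ n.
set e := euler_cdf q k n; set e' := euler_cdf q k n.-1 => IHn IHn1 tr.
rewrite (_ : _ - _ = (z - (s * x + (1 - s) * y)) + (s * (x - e) + (1 - s) * (y - e'))); last by ring.
have -> : k.+1%:R * B = B + k%:R * B by rewrite -natr1; ring.
rewrite (le_trans (ler_normD _ _))// lerD//.
  exact: le_trans trB.
rewrite (le_trans (ler_normD _ _))// !normrM [X in X * _ + _]ger0_norm// [X in _ + X * _]ger0_norm ?subr_ge0//.
rewrite (@le_trans _ _ (s * (k%:R * B) + (1 - s) * (k%:R * B)))//.
  by rewrite lerD// ler_wpM2l ?subr_ge0.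
by rewrite -mulrDl addrC subrK mul1r.
Qed.

(** Here q^(m+1) is exactly exp(-x), and 1 - q <= x / (m + 1), so m + 1 steps cost at most C / (m +
    1) in total. *)
Lemma cvg_euler_cdf (x : R) n : 0 <= x ->
  euler_cdf (expR (- (x / m.+1%:R))) m.+1 n @[m --> \oo] -->
  1 - (1 - expR (- x)) ^+ n.
Proof.
move=> x0.
suff : `|1 - (1 - expR (- x)) ^+ n - euler_cdf (expR (- (x / m.+1%:R))) m.+1 n|
    @[m --> \oo] --> 0.
  move=> /norm_cvg0 H; rewrite -[X in _ --> X]subr0.
  under eq_fun do rewrite -[euler_cdf _ _ _](subKr (1 - (1 - expR (- x)) ^+ n)).
  by apply: cvgB => //; exact: cvg_cst.
pose C := 2 * n%:R ^+ 2 * x ^+ 2.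
apply: (@squeeze_cvgr _ _ _ _ (fun=> 0) (fun m => C * m.+1%:R^-1)).
- apply: nearW => m; rewrite normr_ge0/=.
  have xm : 0 <= x / m.+1%:R by rewrite divr_ge0.
  have q01 : 0 <= expR (- (x / m.+1%:R)) <= 1.
    by rewrite expR_ge0/= -[leRHS]expR0 ler_expR oppr_le0.
  have := euler_cdf_error _ m.+1 n n q01 (leqnn n).
  rewrite -expRM_natl mulrN mulrCA divff ?pnatr_eq0// mulr1 => /le_trans; apply.
  have q1 : 0 <= 1 - expR (- (x / m.+1%:R)) <= x / m.+1%:R.
    move: q01 => /andP[_ q1]; rewrite subr_ge0 q1/=.
    by move: (expR_ge1Dx (- (x / m.+1%:R))); set y := x / _; lra.
  apply: (@le_trans _ _ (m.+1%:R * (2 * n%:R ^+ 2 * (x / m.+1%:R) ^+ 2))).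
    rewrite ler_wpM2l// ler_wpM2l ?mulr_ge0 ?sqr_ge0//.
    by move: q1 => /andP[? ?]; rewrite lerXn2r ?nnegrE.
  rewrite le_eqVlt; apply/orP; left; apply/eqP; rewrite /C; field.
  by rewrite addrC natr1 pnatr_eq0.
- exact: cvg_cst.
- rewrite -[X in _ --> X](mulr0 C); apply: cvgM; first exact: cvg_cst.
  exact: cvg_harmonic.
Qed.

(* (1 - p) ^ floor (x / p) lies between exp (- x / (1 - p)) and exp (p - x). *)
Lemma cvg_geometric_tail (f : R -> R) (g : R -> nat) (x : R) :
  0 <= x -> (forall t, 0 < f t) -> f t @[t --> +oo] --> 0 ->
  (forall t, g t = Num.truncn (x / f t)) ->
  (1 - f t) ^+ g t @[t --> +oo] --> expR (- x).
Proof.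
move=> x0 f0 fcvg gE.
apply: (@squeeze_cvgr _ _ _ _ (fun t => expR (- (x / (1 - f t)))) (fun t => expR (f t - x))).
- near=> t.
  have f1 : f t < 1 by near: t; apply: (cvgr_lt 0 fcvg).
  have := f0 t; set p := f t in f1 * => p0.
  have xp0 : 0 <= x / p by rewrite divr_ge0// ltW.
  have /andP[gl gu] := Num.Theory.truncn_itv xp0; rewrite -gE in gl gu.
  set n := g t in gl gu *.
  have gl' : n%:R * p <= x by rewrite -ler_pdivlMr.
  have gu' : x < (n%:R + 1) * p by rewrite -ltr_pdivrMr// natr1.
  apply/andP; split.
    (* The lower bound uses n p <= x and 1 / (1 - p) = 1 + p / (1 - p) <= exp(p / (1 - p)); the
       upper one uses 1 - p <= exp(-p) and n p > x - p. *)
    apply: (@le_trans _ _ (expR (- (p / (1 - p))) ^+ n)).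
      rewrite -expRM_natl ler_expR mulrN lerN2 mulrA ler_pM2r ?invr_gt0; lra.
    rewrite lerXn2r ?nnegrE ?expR_ge0//; first by lra.
    rewrite expRN -[leRHS]invrK lef_pV2 ?posrE ?expR_gt0 ?invr_gt0//; last by lra.
    apply: le_trans (expR_ge1Dx _); rewrite le_eqVlt; apply/orP; left; apply/eqP.
    by field; lra.
  apply: (@le_trans _ _ (expR (- p) ^+ n)).
    rewrite lerXn2r ?nnegrE ?expR_ge0//; first by lra.
    exact: expR_ge1Dx.
  by rewrite -expRM_natl ler_expR; lra.
- apply: continuous_cvg; first exact: continuous_expR.
  apply: cvgN; rewrite -[X in _ --> X]mulr1 -[1 in X in _ --> X]invr1.
  apply: cvgM; first exact: cvg_cst.
  apply: cvgV => //; rewrite -[X in _ --> X]subr0.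
  by apply: cvgB => //; exact: cvg_cst.
- apply: continuous_cvg; first exact: continuous_expR.
  by rewrite -[X in _ --> X]add0r; apply: cvgB => //; exact: cvg_cst.
Unshelve. all: by end_near. Qed.

End EulerCdf.

(** * Geometric law and mean of the volume *)

Section Probability.
Context {d} {T : measurableType d} {R : realType} (P : probability T R).

(** Dominated convergence for indicators, bounded by 1. *)
Lemma cvg_prob_ae (E : nat -> set T) (A : set T) :
  (forall m, measurable (E m)) -> measurable A ->
  {ae P, forall w, \forall m \near \oo, E m w <-> A w} ->
  P (E m) @[m --> \oo] --> P A.
Proof.
move=> mE mA EA.
have PI B : measurable B -> P B = (\int[P]_w (\1_B w)%:E)%E.
  by move=> mB; rewrite integral_indic// setIT.
rewrite PI//; under eq_fun do rewrite PI//.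
have [|||||_ _ //] := @dominated_convergence _ _ _ P _ measurableT
  (fun m w => (\1_(E m) w)%:E) (fun w => (\1_A w)%:E) (cst 1%E).
- by move=> m; apply/measurable_EFinP; exact: measurable_indic.
- by apply/measurable_EFinP; exact: measurable_indic.
- apply: filterS EA => w EAw _; apply: cvg_near_cst.
  apply: filterS EAw => m [EmA AEm]; congr EFin; rewrite !indicE.
  by congr ((nat_of_bool _)%:R); apply/idP/idP; rewrite !inE.
- by apply/integrableP; split=> //; under eq_integral do rewrite /= normr1;
     rewrite integral_cst//= mul1e probability_setT ltry.
- by apply: aeW => w m _; rewrite /= lee_fin ger0_norm ?indicE ?lern1 ?leq_b1.
Qed.

Variables (lambda : R) (G : R -> T -> rtree).
Hypothesis lambda_gt0 : 0 < lambda.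
Hypothesis G_tree : pure_birth_tree P lambda G.

Lemma measurable_volume_le t n : 0 <= t ->
  measurable [set w | (volume (G t w) <= n)%N].
Proof.
move=> t0; rewrite (_ : [set _ | _] = \bigcup_(x : rtree)
   (if (volume x <= n)%N then G t @^-1` [set x] else set0)).
  apply: countable_bigcupT_measurable => [|x]; first exact: countableP.
  by case: ifP => // _; apply: (markov_measurable G_tree.1).
apply/seteqP; split=> w /=; first by move=> vn; exists (G t w); rewrite ?vn.
by move=> [x _]; case: ifP => // vn /= ->.
Qed.

(** The probabilities of the scheme events have two limits, one by pathwise exactness and one by the
    explicit law; they must coincide. *)
Lemma prob_volume_le t n : 0 <= t ->
  P [set w | (volume (G t w) <= n)%N] = (1 - (1 - expR (- (lambda * t))) ^+ n)%:E.
Proof.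
move=> t0; have [_ [clock [poi ind start right jump]]] := G_tree.
pose h (m : nat) : R := t / m.+1%:R.
have h0 m : 0 <= h m by rewrite divr_ge0.
pose E m := [set w | (euler (rings clock (h m) w) m.+1 <= n)%N].
have PE m : P (E m) = (euler_cdf (expR (- (lambda * t / m.+1%:R))) m.+1 n)%:E.
  by rewrite (prob_euler_le P lambda clock lambda_gt0 poi ind)// mulrA.
have cvg1 : P (E m) @[m --> \oo] --> P [set w | (volume (G t w) <= n)%N].
  apply: cvg_prob_ae => [m||]; [exact: (measurable_euler_le P lambda clock poi)|exact: measurable_volume_le|].
  have paths := ae_foralln (fun v => poisson_path (poi v)).
  apply: filterS2 paths (filterI start (filterI right jump)) => w pw [sw [rw jw]].
  have ex : \forall m \near \oo, euler (rings clock (h m) w) m.+1 = volume (G t w).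
    apply: (euler_exact (G ^~ w) (fun v s => clock v s w)) => //.
      by move=> v; exact: (pw v).1.
    by move=> v; exact: (pw v).2.
  by apply: filterS ex => m; rewrite /E /mkset => ->.
have cvg2 : P (E m) @[m --> \oo] --> (1 - (1 - expR (- (lambda * t))) ^+ n)%:E.
  under eq_fun do rewrite PE.
  by apply: cvg_EFin; [exact: nearW|apply: cvg_euler_cdf; rewrite mulr_ge0// ltW].
by rewrite -(cvg_lim _ cvg1)// -(cvg_lim _ cvg2).
Qed.

Lemma nneseries_ltn (n : nat) :
  (\sum_(0 <= k <oo) ((k < n)%N%:R : R)%:E = (n%:R)%:E)%E.
Proof.
apply/cvg_lim => //; apply: cvg_near_cst; near=> m.
have nm : (n <= m)%N by near: m; exact: nbhs_infty_ge.
rewrite sumEFin big_mkord -natr_sum; congr ((_%:R)%:E).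
rewrite -[RHS]card_ord -sum1_card (big_ord_widen _ (fun=> 1%N) nm) [RHS]big_mkcond.
by apply: eq_bigr => k _; case: (k < n)%N.
Unshelve. all: by end_near. Qed.

(** The mean is the sum of the tails P(N > k) = (1 - p)^k, a geometric series with sum 1/p. *)
Lemma expectation_volume t : 0 <= t ->
  ('E_P[fun w => (volume (G t w))%:R] = (expR (lambda * t))%:E)%E.
Proof.
move=> t0; set p := expR (- (lambda * t)).
have p0 : 0 < p by exact: expR_gt0.
have p1 : p <= 1 by rewrite -[leRHS]expR0 ler_expR oppr_le0 mulr_ge0// ltW.
pose A k := ~` [set w | (volume (G t w) <= k)%N].
have mA k : measurable (A k) by apply: measurableC; exact: measurable_volume_le.
have PA k : P (A k) = ((1 - p) ^+ k)%:E.
  rewrite probability_setC ?prob_volume_le//; last exact: measurable_volume_le.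
  by rewrite -EFinB; congr EFin; rewrite opprB addrC subrK.
rewrite unlock (eq_integral (fun w => \sum_(0 <= k <oo) (\1_(A k) w)%:E)%E); last first.
  move=> w _; rewrite -nneseries_ltn; apply: eq_eseriesr => k _; congr EFin.
  rewrite indicE; congr ((nat_of_bool _)%:R); rewrite ltnNge.
  by apply/idP/idP; rewrite inE => /negP.
rewrite integral_nneseries//; last first.
  by move=> n; apply/measurable_EFinP; exact: measurable_indic.
have IA k : (\int[P]_w (\1_(A k) w)%:E = ((1 - p) ^+ k)%:E)%E.
  by rewrite -PA integral_indic// setIT.
under eq_eseriesr do rewrite IA.
apply/cvg_lim => //.
under eq_fun do rewrite sumEFin.
apply: cvg_EFin; first exact: nearW.
have -> : expR (lambda * t) = 1 / (1 - (1 - p)).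
  by rewrite opprB addrC subrK div1r /p expRN invrK.
rewrite (_ : _ \o _ = series (geometric 1 (1 - p))).
  by apply: cvg_geometric_series; rewrite ger0_norm; lra.
by apply/funext => n /=; apply: eq_bigr => k _; rewrite /geometric /= mul1r.
Qed.

End Probability.

(** * Convergence to the exponential law *)

Lemma exponential_prob_itvNyc {R : realType} (x : R) :
  exponential_prob 1 `]-oo, x] = (if 0 <= x then 1 - expR (- x) else 0)%:E.
Proof.
have -> : exponential_prob 1 `]-oo, x] = exponential_prob 1 (`]-oo, x] `&` `[0, +oo[).
  rewrite /exponential_prob integral_mkcondr; apply: eq_integral => y _.
  rewrite patchE; case: ifPn => // y0; congr EFin; apply: lt0_exponential_pdf.
  by move: y0; rewrite notin_setE /= in_itv/= andbT => /negP; rewrite -ltNge.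
have [x0|x0] := leP 0 x; last first.
  rewrite (_ : _ `&` _ = set0) ?/exponential_prob ?integral_set0//.
  apply/seteqP; split=> // y [] /=; rewrite !in_itv/= andbT => yx y0.
  by have := le_trans y0 yx; rewrite leNgt x0.
rewrite (_ : _ `&` _ = `[0, x]%classic); last first.
  apply/seteqP; split=> y /=; rewrite !in_itv/= andbT.
    by move=> [-> ->].
  by move=> /andP[-> ->].
move: x0; rewrite le_eqVlt => /predU1P[<-|x0].
  by rewrite set_itv1 /exponential_prob integral_set1 oppr0 expR0 subrr.
by rewrite exponential_prob_itv0c// mulN1r.
Qed.

Theorem theorem4p1 (d : measure_display) (T : measurableType d) (R : realType)
    (P : probability T R) (lambda : R) (G : R -> T -> rtree) :
  0 < lambda -> pure_birth_tree P lambda G ->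
  let N := fun (t : R) (w : T) => (volume (G t w))%:R : R in
  (forall t : R, 0 <= t -> ('E_P[N t] = (expR (lambda * t))%:E)%E) /\
  converges_in_distribution P (fun t w => N t w / fine ('E_P[N t])%E)
    (exponential_prob 1).
Proof.
move=> lambda0 GT N.
have EN t : 0 <= t -> ('E_P[N t] = (expR (lambda * t))%:E)%E.
  exact: expectation_volume.
split=> // x _; rewrite exponential_prob_itvNyc.
pose f t := expR (- (lambda * t)).
have fV t : 0 <= t -> (fine 'E_P[N t])^-1 = f t.
  by move=> t0; rewrite EN//= /f expRN.
have f0 t : 0 < f t by exact: expR_gt0.
have fcvg : f t @[t --> +oo] --> 0.
  apply: (cvg_comp (fun t => lambda * t) (fun y => expR (- y))); last exact: cvgr_expR.
  exact: gt0_cvgMry.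
case: leP => [x0|x0]; last first.
  apply: cvg_near_cst; near=> t.
  have t0 : 0 <= t by near: t; exact: nbhs_pinfty_ge.
  rewrite (_ : [set _ | _] = set0) ?measure0//; apply/seteqP; split=> // w /=.
  by rewrite fV// leNgt (lt_le_trans x0)// mulr_ge0// ltW.
(* N is an integer, so p N <= x means N <= floor(x / p), and the geometric law applies. *)
pose g t := Num.truncn (x / f t).
have H : (1 - (1 - f t) ^+ g t)%:E @[t --> +oo] --> (1 - expR (- x))%:E.
  apply: cvg_EFin; first exact: nearW.
  by apply: cvgB; [exact: cvg_cst|exact: cvg_geometric_tail].
apply: cvg_trans H; apply: near_eq_cvg; near=> t.
have t0 : 0 <= t by near: t; exact: nbhs_pinfty_ge.
rewrite -(prob_volume_le P lambda G lambda0 GT)//; congr (P _).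
apply/seteqP; split=> w /=;
by rewrite fV// -ler_pdivlMr// Num.Theory.truncn_ge_nat// divr_ge0// ltW.
Unshelve. all: by end_near. Qed.
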